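(* Let $a<b$ be real numbers and let $h:[a,b]\to\mathbb{R}$ have a continuous first derivative that is uniformly bounded on $[a,b]$. For $n\ge2$ define $x_{i,n}=a+(b-a)\frac{i-1}{n-1}$, $i=1,\dots,n$. Let $\varepsilon_1,\varepsilon_2,\dots$ be i.i.d. random variables with a non-degenerate cdf $F_\varepsilon$, mean $0$ and finite variance, and put $Y_{i,n}=h(x_{i,n})+\varepsilon_i$. Define $$A_n=\frac{1}{\sqrt n}\sum_{i=2}^n\big(Y_{i,n}-Y_{i-1,n}\big)_+,\qquad B_n=\frac{1}{\sqrt n}\sum_{i=2}^n\big|Y_{i,n}-Y_{i-1,n}\big|,\qquad I_n=\frac{A_n}{B_n},$$ where $x_+=\max\{x,0\}$. Then $I_n\to 1/2$ in probability as $n\to\infty$. *)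

(* Defs.v *)
From HB Require Import structures.
From mathcomp Require Import all_boot all_order all_algebra.
From mathcomp Require Import all_classical all_reals all_analysis.
Set Implicit Arguments. Unset Strict Implicit. Unset Printing Implicit Defensive.
Import Order.TTheory GRing.Theory Num.Theory.
Import numFieldNormedType.Exports.
Local Open Scope classical_set_scope.
Local Open Scope ring_scope.

Definition mutually_independent d (T : measurableType d) (R : realType)
    (P : probability T R) (X : nat -> {RV P >-> R}) : Prop :=
  forall (J : seq nat) (B : nat -> set R), uniq J ->
    (forall j, j \in J -> measurable (B j)) ->
    P (\big[setI/setT]_(j <- J) (X j @^-1` B j)) =
    (\prod_(j <- J) P (X j @^-1` B j))%E.

Definition iid d (T : measurableType d) (R : realType)
    (P : probability T R) (X : nat -> {RV P >-> R}) : Prop :=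
  mutually_independent X /\ forall i, cdf (X i) = cdf (X 0%N).

Definition degenerate_cdf (R : realType) (F : R -> \bar R) : Prop :=
  exists c : R, forall r, F r = (if c <= r then 1%E else 0%E).

Definition xdes (R : realType) (a b : R) (n i : nat) : R :=
  a + (b - a) * ((i.-1)%:R / (n.-1)%:R).

(* Y_{i,n} = h(x_{i,n}) + eps_i ; paper's eps_i is eps (i-1) here (0-based). *)
Definition Yobs d (T : measurableType d) (R : realType) (P : probability T R)
    (h : R -> R) (a b : R) (eps : nat -> {RV P >-> R}) (n i : nat) (w : T) : R :=
  h (xdes a b n i) + eps i.-1 w.

Definition A_stat d (T : measurableType d) (R : realType) (P : probability T R)
    (h : R -> R) (a b : R) (eps : nat -> {RV P >-> R}) (n : nat) (w : T) : R :=
  (Num.sqrt n%:R)^-1 *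
  \sum_(2 <= i < n.+1) Num.max (Yobs h a b eps n i w - Yobs h a b eps n i.-1 w) 0.

Definition B_stat d (T : measurableType d) (R : realType) (P : probability T R)
    (h : R -> R) (a b : R) (eps : nat -> {RV P >-> R}) (n : nat) (w : T) : R :=
  (Num.sqrt n%:R)^-1 *
  \sum_(2 <= i < n.+1) `|Yobs h a b eps n i w - Yobs h a b eps n i.-1 w|.

Definition I_stat d (T : measurableType d) (R : realType) (P : probability T R)
    (h : R -> R) (a b : R) (eps : nat -> {RV P >-> R}) (n : nat) (w : T) : R :=
  A_stat h a b eps n w / B_stat h a b eps n w.

Definition cvg_in_prob d (T : measurableType d) (R : realType)
    (P : probability T R) (Z : nat -> T -> R) (c : R) : Prop :=
  forall e : R, 0 < e ->
    (fun n => P [set w | e <= `|Z n w - c|]) @ \oo --> 0%E.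

(* Main.v *)
Require Import Defs.
From HB Require Import structures.
From mathcomp Require Import all_boot all_order all_algebra.
From mathcomp Require Import all_classical all_reals all_analysis.
From mathcomp Require Import measurable_realfun.
From mathcomp Require Import zify ring lra.
Import Order.TTheory GRing.Theory Num.Theory.
Import numFieldNormedType.Exports.
Local Open Scope classical_set_scope.
Local Open Scope ring_scope.

(** Since [x_+ = (|x| + x) / 2], the sum defining [A_n] telescopes and
[I_n - 1/2 = (Y_n - Y_1) / (2 S_n)], where [S_n] is the total variation of
[Y_1, ..., Y_n]. The numerator is tight because [h] is bounded and the errors
are identically distributed, so it suffices that [S_n] tends to infinity in
probability. As [h] is Lipschitz, [S_n] is at least the variation of the errors
minus a constant. Non-degeneracy gives [s < t] with [0 < F s] and [F t < 1]; cut
the errors into [m] blocks of length [L]. A block whose variation is smaller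
than [t - s] has all its errors [> s] or all its errors [<= t], which by
independence has probability at most [(1 - F s)^L + (F t)^L]. Hence the
variation is at least [m (t - s)] outside an event whose probability vanishes
as [L] grows. *)

(** * Two facts from real analysis: inversion and the mean value theorem *)

(** Inversion is continuous off [0], and any function is measurable on the singleton [0]. *)
Lemma measurable_invr (R : realType) :
  measurable_fun [set: R] (fun x : R => x^-1).
Proof.
rewrite -(setUv [set 0 : R]); apply/measurable_funU => //.
  exact: measurableC.
split; first exact: measurable_fun_set1.
apply: open_continuous_measurable_fun.
  by apply: closed_openC; exact: closed_eq.
move=> x /set_mem /= /eqP x0; exact: inv_continuous.
Qed.

Lemma derive_bounded_lipschitz (R : realType) (h : R -> R) (a b M : R) :
  {within `[a, b], continuous h} ->
  (forall x, x \in `]a, b[ -> derivable h x 1) ->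
  (forall x, x \in `]a, b[ -> `|(derive1 h) x| <= M) ->
  forall x y, a <= x -> x < y -> y <= b -> `|h y - h x| <= M * (y - x).
Proof.
move=> hc hd hM x y ax xy yb.
have sub z : z \in `]x, y[ -> z \in `]a, b[.
  by rewrite !in_itv/= => /andP[? ?]; apply/andP; split; lra.
have [||c cxy ->] := @MVT R h (derive1 h) x y xy.
- by move=> z /sub zab; rewrite derive1E; apply/derivableP; exact: hd.
- apply: continuous_subspaceW hc => z /=; rewrite !in_itv/= => /andP[? ?].
  by apply/andP; split; lra.
rewrite normrM (ger0_norm (x := y - x)); last lra.
by apply: ler_wpM2r; [lra | exact/hM/sub].
Qed.

(** * Variation of a deterministic sequence *)

Lemma ler_dist_variation (R : realDomainType) (u : nat -> R) (i j : nat) :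
  (i <= j)%N -> `|u j - u i| <= \sum_(i <= k < j) `|u k.+1 - u k|.
Proof. by move=> ij; rewrite -telescope_sumr//; exact: ler_norm_sum. Qed.

Lemma ler_dist_variation_sub {R : realDomainType} (u : nat -> R)
    (p q i j : nat) :
  (p <= i <= q)%N -> (p <= j <= q)%N ->
  `|u j - u i| <= \sum_(p <= k < q) `|u k.+1 - u k|.
Proof.
wlog ij : i j / (i <= j)%N => [H ip jp|/andP[pi iq] /andP[pj jq]].
  by case/orP: (leq_total i j) => ij; [|rewrite distrC]; exact: H.
rewrite (big_cat_nat (n := i))//= (big_cat_nat (m := i) (n := j))//=.
have ? := @ler_dist_variation R u i j ij.
have ? : 0 <= \sum_(p <= k < i) `|u k.+1 - u k| by exact: sumr_ge0.
have ? : 0 <= \sum_(j <= k < q) `|u k.+1 - u k| by exact: sumr_ge0.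
lra.
Qed.

(** Each block holds a value at most [s] and one above [t], so its increments contribute at least
    [t - s]; distinct blocks use disjoint sets of increments. *)
Lemma variation_ge_blocks (R : realDomainType) (u : nat -> R) (s t : R)
    (m L : nat) :
  (forall j, (j < m)%N ->
     (exists2 i, (j * L <= i < j.+1 * L)%N & u i <= s) /\
     (exists2 i, (j * L <= i < j.+1 * L)%N & t < u i)) ->
  m%:R * (t - s) <= \sum_(0 <= k < m * L) `|u k.+1 - u k|.
Proof.
elim: m => [_|m IH H]; first by rewrite mul0r mul0n big_geq.
have {}IH := IH (fun j jm => H j (leqW jm)).
have [[i iL us] [j jL ut]] := H m (leqnn _).
rewrite (big_cat_nat (n := (m * L)%N))//=;
  last by rewrite leq_mul2r leqnSn orbT.
have := @ler_dist_variation_sub R u (m * L) (m.+1 * L) i j.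
have -> : (m * L <= i <= m.+1 * L)%N by move: iL; lia.
have -> : (m * L <= j <= m.+1 * L)%N by move: jL; lia.
move=> /(_ isT isT).
have ? := ler_norm (u j - u i).
rewrite -natr1 mulrDl mul1r => ?; lra.
Qed.

(** Triangle inequality applied to each increment: a drift [g] costs at most [c] per step. *)
Lemma variation_addl_ge (R : realDomainType) (g u : nat -> R) (c : R)
    (n : nat) :
  (forall k, (k < n)%N -> `|g k.+1 - g k| <= c) ->
  \sum_(0 <= k < n) `|u k.+1 - u k| - n%:R * c <=
  \sum_(0 <= k < n) `|(g k.+1 + u k.+1) - (g k + u k)|.
Proof.
move=> gc.
suff: \sum_(0 <= k < n) `|u k.+1 - u k| <=
      \sum_(0 <= k < n) (`|(g k.+1 + u k.+1) - (g k + u k)| + c).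
  by rewrite big_split/= sumr_const_nat subn0 mulr_natl lerBlDr.
apply: ler_sum_nat => k /andP[_ kn].
rewrite (_ : u k.+1 - u k = (g k.+1 + u k.+1) - (g k + u k) -
    (g k.+1 - g k)); last by ring.
apply: le_trans (ler_normB _ _) _; rewrite lerD2l; exact: gc.
Qed.

(** * Pathwise analysis of the statistic *)

Section statistics.
Context {R : realType} {d : measure_display} {T : measurableType d}.
Context {P : probability T R}.
Variables (h : R -> R) (a b : R) (eps : nat -> {RV P >-> R}).

Lemma measurable_I_stat (n : nat) : measurable_fun setT (I_stat h a b eps n).
Proof.
have mY i : measurable_fun setT
    (fun w => Yobs h a b eps n i w - Yobs h a b eps n i.-1 w).
  by apply: measurable_funB; apply: measurable_funD.
apply: measurable_funM; last apply: (measurableT_comp (measurable_invr R)).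
  apply: measurable_funM => //; apply: measurable_sum => i.
  exact: measurable_maxr.
apply: measurable_funM => //; apply: measurable_sum => i.
exact: measurableT_comp.
Qed.

(** The identity [I_n - 1/2 = (Y_n - Y_1) / (2 S)] with the denominator cleared, so that the
    statement also covers [S = 0]. *)
Lemma I_stat_deviation (n : nat) (w : T) (e : R) : (1 < n)%N ->
  e <= `|I_stat h a b eps n w - 1 / 2| ->
  2 * e * \sum_(0 <= k < n.-1)
      `|Yobs h a b eps n k.+2 w - Yobs h a b eps n k.+1 w| <=
  `|Yobs h a b eps n n w - Yobs h a b eps n 1 w|.
Proof.
case: n => [//|n] n0; rewrite /I_stat /A_stat /B_stat.
rewrite !(big_add1 _ _ 1%N) !(big_add1 _ _ 0%N)/=.
set Y := Yobs h a b eps n.+1.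
set S := \sum_(0 <= k < n) `|Y k.+2 w - Y k.+1 w|.
have -> : \sum_(0 <= k < n) Num.max (Y k.+2 w - Y k.+1 w) 0 =
    (S + (Y n.+1 w - Y 1%N w)) / 2.
  have <- : \sum_(0 <= k < n) (Y k.+2 w - Y k.+1 w) = Y n.+1 w - Y 1%N w.
    exact: (telescope_sumr (fun k => Y k.+1 w)).
  rewrite /S -big_split/= mulr_suml; apply: eq_bigr => k _.
  by rewrite maxr_absE subr0 addr0 addrC.
have sq0 : Num.sqrt n.+1%:R != 0 :> R by rewrite gt_eqF// sqrtr_gt0.
(* If [S = 0], the quotient takes its default value, but the cleared bound is just
   [0 <= |Y_n - Y_1|]. *)
have [->|S0] := eqVneq S 0; first by move=> _; rewrite mulr0.
have Sp : 0 < S by rewrite lt_neqAle eq_sym S0; exact: sumr_ge0.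
set D := Y n.+1 w - Y 1%N w.
rewrite (_ : _ - _ = D / (2 * S)); last by field; rewrite S0 sq0.
rewrite normrM normfV (ger0_norm (x := 2 * S)); last by lra.
by rewrite ler_pdivlMr; [rewrite mulrA (mulrC e) | lra].
Qed.

(** The mesh is [(b - a) / (n - 1)], so each of the [n - 1] drift increments is at most [M] times
    that: the total loss does not depend on [n]. *)
Lemma Yobs_variation_ge (M : R) (n : nat) (w : T) : a < b ->
  {within `[a, b], continuous h} ->
  (forall x, x \in `]a, b[ -> derivable h x 1) ->
  (forall x, x \in `]a, b[ -> `|(derive1 h) x| <= M) ->
  (1 < n)%N ->
  \sum_(0 <= k < n.-1) `|eps k.+1 w - eps k w| - M * (b - a) <=
  \sum_(0 <= k < n.-1) `|Yobs h a b eps n k.+2 w - Yobs h a b eps n k.+1 w|.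
Proof.
move=> ab hc hd hM; case: n => [//|n]/=; rewrite ltnS => n0.
have n0R : 0 < n%:R :> R by rewrite ltr0n.
have := @variation_addl_ge R (fun k => h (xdes a b n.+1 k.+1))
  (fun k => eps k w) (M * (b - a) / n%:R) n.
rewrite (mulrC n%:R) divfK ?gt_eqF//; apply => k kn /=.
rewrite (_ : M * _ / _ = M * (xdes a b n.+1 k.+2 - xdes a b n.+1 k.+1));
  last first.
  by rewrite /xdes/= -natr1; field; rewrite gt_eqF.
have dx (i : R) : a + (b - a) * (i / n%:R) = a + (b - a) / n%:R * i by ring.
have c0 : 0 < (b - a) / n%:R by rewrite divr_gt0// subr_gt0.
apply: (derive_bounded_lipschitz R h a b M hc hd hM); rewrite /xdes/= !dx.
- by rewrite lerDl mulr_ge0// ltW.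
- by rewrite ltrD2l ltr_pM2l// ltr_nat.
- rewrite -lerBrDl mulrAC ler_pdivrMr// ler_pM2l ?subr_gt0//.
  by rewrite ler_nat.
Qed.

End statistics.

(** * Two separating levels for a non-degenerate distribution *)

(** By contraposition: without such levels, [s < t] forces [F s = 0] or [F t = 1], so [F] jumps from
    0 to 1 at the infimum of the set where it is positive. *)
Lemma nondegenerate_cdfP {R : realType} {d : measure_display}
    {T : measurableType d} {P : probability T R} (X : {RV P >-> R}) :
  ~ degenerate_cdf (cdf X) ->
  exists s t : R, [/\ s < t, (0 < cdf X s)%E & (cdf X t < 1)%E].
Proof.
move=> ndeg; apply: contrapT => nst; apply: ndeg.
have dich s t : s < t -> cdf X s = 0%E \/ cdf X t = 1%E.
  move=> st; have [cs|cs] := eqVneq (cdf X s) 0%E; first by left.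
  right; apply/eqP/negPn/negP => ct; apply: nst; exists s, t; split => //.
    by rewrite lt_neqAle eq_sym cs cdf_ge0.
  by rewrite lt_neqAle ct cdf_le1.
pose E := [set r | (0 < cdf X r)%E].
have [r0 Er0] : E !=set0.
  apply: contrapT => E0.
  have : (1 <= 0 :> \bar R)%E; last by rewrite lee_fin ler10.
  apply: (cvge_to_le (cvg_cdfy1 X)); apply: nearW => r.
  by rewrite leNgt; apply/negP => Er; apply: E0; exists r.
(* Otherwise every [r] has a point of [E] below it, so [F r = 1] for all [r], against the limit 0 at
   minus infinity. *)
have Elb : has_lbound E.
  apply: contrapT => nlb.
  have : (1 <= 0 :> \bar R)%E; last by rewrite lee_fin ler10.
  apply: (cvge_to_ge (cvg_cdfNy0 X)); apply: nearW => r.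
  apply: contrapT => r1; apply: nlb; exists r => s Es.
  rewrite leNgt; apply/negP => sr; apply: r1.
  by case: (dich s r sr) => [s0|->//]; move: Es; rewrite /E/= s0 ltxx.
have hE : has_inf E by split => //; exists r0.
have gtc t : inf E < t -> cdf X t = 1%E.
  move=> /inf_lt => /(_ hE.1)[s Es st].
  by case: (dich s t st) => // s0; move: Es; rewrite /E/= s0 ltxx.
exists (inf E) => r; case: ifPn => [cr|].
  apply/eqP; rewrite eq_le cdf_le1/=.
  (* At [inf E] itself the value 1 comes from right continuity, and monotonicity carries it to
     [r]. *)
  apply: le_trans (cdf_nondecreasing X cr).
  apply: (cvge_to_ge (@cdf_right_continuous _ _ _ _ X (inf E))).
  by near=> t; rewrite gtc//; near: t; exact: nbhs_right_gt.
rewrite -ltNge => rc; apply/eqP; rewrite eq_le cdf_ge0 andbT leNgt.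
apply/negP => Er; suff : inf E <= r by rewrite leNgt rc.
exact: ge_inf.
Unshelve. all: by end_near. Qed.

Lemma measurable_preim_itv {R : realType} {d : measure_display}
    {T : measurableType d} (f : T -> R) (i : interval R) :
  measurable_fun setT f -> measurable (f @^-1` [set` i]).
Proof. by move=> mf; rewrite -[_ @^-1` _]setTI; exact: mf. Qed.

(** * Probability bounds for the i.i.d. errors *)

Section iid_sequences.
Context {R : realType} {d : measure_display} {T : measurableType d}.
Context {P : probability T R}.
Variable eps : nat -> {RV P >-> R}.

Lemma iid_ccdf (i : nat) : iid eps -> ccdf (eps i) = ccdf (eps 0%N).
Proof. by move=> [_ ic]; apply/funext => r; rewrite !ccdf_1_cdf ic. Qed.

(** The upper bound is written [L + m] so that, for [m = j * L], it is convertible to [j.+1 * L]. *)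
Lemma independent_block (B : set R) (p : R) (m L : nat) :
  mutually_independent eps -> measurable B ->
  (forall i, P (eps i @^-1` B) = p%:E) ->
  P (\big[setI/setT]_(m <= i < L + m) (eps i @^-1` B)) = (p ^+ L)%:E.
Proof.
move=> ind mB eqp; rewrite (ind _ (fun=> B)) ?iota_uniq//.
rewrite (eq_bigr (fun=> p%:E))// -{2}(addnK m L) -(prodr_const_nat _ _ p).
by elim/big_rec2: _ => // i x y _ ->.
Qed.

(** The failure, on block [j], of the hypothesis of [variation_ge_blocks], as a union of two events
    that independence evaluates. *)
Definition flat_block (s t : R) (L j : nat) : set T :=
  \big[setI/setT]_(j * L <= i < j.+1 * L) (eps i @^-1` `]s, +oo[) `|`
  \big[setI/setT]_(j * L <= i < j.+1 * L) (eps i @^-1` `]-oo, t]).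

Lemma small_variation_sub (s t : R) (m L : nat) :
  [set w | \sum_(0 <= k < m * L) `|eps k.+1 w - eps k w| < m%:R * (t - s)] `<=`
  \big[setU/set0]_(j < m) flat_block s t L j.
Proof.
rewrite -(bigcup_mkord m (flat_block s t L)) => w /= small.
apply: contrapT => nU.
move: small; apply/negP; rewrite -leNgt.
apply: (@variation_ge_blocks R (fun i => eps i w)) => j jm; split.
- apply: contrapT => nE; apply: nU; exists j => //; left.
  rewrite -bigcap_seq => i /=; rewrite mem_index_iota => ij.
  by rewrite in_itv/= andbT ltNge; apply/negP => es; apply: nE; exists i.
- apply: contrapT => nE; apply: nU; exists j => //; right.
  rewrite -bigcap_seq => i /=; rewrite mem_index_iota => ij.
  by rewrite in_itv/= leNgt; apply/negP => es; apply: nE; exists i.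
Qed.

Definition variation (n : nat) (w : T) :=
  \sum_(0 <= k < n) `|eps k.+1 w - eps k w|.

Lemma measurable_variation n : measurable_fun setT (variation n).
Proof.
apply: measurable_sum => k; apply: measurableT_comp => //.
exact: measurable_funB.
Qed.

(** Union bound over the [m] blocks and over the two halves of each [flat_block], whose
    probabilities are [p ^+ L] and [q ^+ L]. *)
Lemma small_variation_le (s t p q : R) (m L : nat) : iid eps ->
  ccdf (eps 0%N) s = p%:E -> cdf (eps 0%N) t = q%:E ->
  (P [set w | (variation (m * L) w < m%:R * (t - s))%R] <=
   (m%:R * (p ^+ L + q ^+ L))%:E)%E.
Proof.
move=> ie ps qt; have [ind ic] := ie.
have mG (j : nat) (i : interval R) :
    measurable (\big[setI/setT]_(j * L <= k < j.+1 * L) (eps k @^-1` [set` i])).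
  by apply: bigsetI_measurable => k _; exact: measurable_preim_itv.
apply: le_trans (le_measure _ _ _ (small_variation_sub s t m L)) _.
- rewrite inE.
  rewrite [X in measurable X](_ : _ =
    variation (m * L) @^-1` `]-oo, (m%:R * (t - s))[).
    by apply: measurable_preim_itv; exact: measurable_variation.
  by apply/seteqP; split => w /=; rewrite in_itv.
- by rewrite inE; apply: bigsetU_measurable => j _; exact: measurableU.
apply: le_trans (Boole_inequality P (A := flat_block s t L) _) _ => [j _|].
  exact: measurableU.
apply: (@le_trans _ _ (\sum_(j < m) (p ^+ L + q ^+ L)%:E)%E); last first.
  by rewrite sumEFin sumr_const card_ord mulr_natl.
apply: lee_sum => j _; apply: le_trans (measureU2 _ _ _) _ => //.
rewrite EFinD; apply: leeD.
- rewrite -(independent_block `]s, +oo[%classic p (j * L) L)// => i.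
  by rewrite -ps -(iid_ccdf i ie).
- rewrite -(independent_block `]-oo, t]%classic q (j * L) L)// => i.
  by rewrite -qt -(ic i).
Qed.

(** The order of choice matters: [m] is fixed first by [c < m (t - s)], then [L] is taken large
    depending on [m]. *)
Lemma variation_unbounded (c eta : R) : iid eps ->
  ~ degenerate_cdf (cdf (eps 0%N)) -> 0 < eta ->
  exists N, forall n, (N <= n)%N ->
    (P [set w | (variation n w <= c)%R] <= eta%:E)%E.
Proof.
move=> ie ndeg eta0.
have [s [t [st Fs Ft]]] := nondegenerate_cdfP _ ndeg.
pose p := fine (ccdf (eps 0%N) s); pose q := fine (cdf (eps 0%N) t).
have ps : ccdf (eps 0%N) s = p%:E by rewrite /p fineK// fin_num_measure.
have qt : cdf (eps 0%N) t = q%:E by rewrite /q fineK// fin_num_measure.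
have p0 : 0 <= p by rewrite fine_ge0.
have q0 : 0 <= q by rewrite fine_ge0.
have q1 : q < 1 by rewrite -lte_fin -qt.
have p1 : p < 1.
  move: Fs; rewrite cdf_1_ccdf ps -EFinB lte_fin; lra.
have st0 : 0 < t - s by lra.
have [m cm] : exists m : nat, c < m%:R * (t - s).
  exists (Num.truncn (`|c| / (t - s))).+1.
  apply: le_lt_trans (ler_norm c) _.
  by rewrite -ltr_pdivrMr// truncnS_gt.
have [L Lle] : exists L, m%:R * (p ^+ L + q ^+ L) <= eta.
  have : (m%:R * (p ^+ L + q ^+ L) @[L --> \oo] --> m%:R * (0 + 0 : R)).
    apply: cvgM; first exact: cvg_cst.
    by apply: cvgD; apply: cvg_expr; rewrite ger0_norm.
  rewrite addr0 mulr0 => /cvgrPdist_le/(_ _ eta0)[L _ /(_ L)/= /(_ (leqnn L))].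
  by rewrite sub0r normrN => le; exists L; exact: le_trans (ler_norm _) le.
exists (m * L)%N => n mLn.
(* The variation grows with [n], so for [n >= m * L] the event at [n] lies in the one at [m * L]. *)
apply: le_trans (le_trans (small_variation_le s t p q m L ie ps qt) _).
  have mE k (i : interval R) : measurable (variation k @^-1` [set` i]).
    by apply: measurable_preim_itv; exact: measurable_variation.
  apply: le_measure; rewrite ?inE.
  - by have := mE n `]-oo, c]; rewrite set_itvE.
  - by have := mE (m * L)%N `]-oo, (m%:R * (t - s))[; rewrite set_itvE.
  move=> w /= wc; apply: le_lt_trans cm; apply: le_trans wc.
  rewrite /variation (big_cat_nat (n := (m * L)%N) (p := n))//= lerDl.
  exact: sumr_ge0.
by rewrite lee_fin.
Qed.

(** Tightness: the cdf vanishes at minus infinity and the ccdf at plus infinity, and the common law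
    makes [K] uniform in [i]. *)
Lemma iid_tail (eta : R) : iid eps -> 0 < eta -> exists2 K : R, 0 <= K &
  forall i, (P (eps i @^-1` `]-oo, (- K)%R]) + P (eps i @^-1` `]K, +oo[) <=
             eta%:E)%E.
Proof.
move=> ie eta0; have e20 : 0 < eta / 2 by lra.
have [K1 K1e] : exists r, (cdf (eps 0%N) r < (eta / 2)%:E)%E.
  apply: contrapT => nr; have : ((eta / 2)%:E <= 0)%E.
    apply: (cvge_to_ge (cvg_cdfNy0 (eps 0%N))); apply: nearW => r.
    by rewrite leNgt; apply/negP => lt; apply: nr; exists r.
  by rewrite lee_fin leNgt e20.
have [K2 K2e] : exists r, (ccdf (eps 0%N) r < (eta / 2)%:E)%E.
  apply: contrapT => nr; have : ((eta / 2)%:E <= 0)%E.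
    apply: (cvge_to_ge (cvg_ccdfy0 (eps 0%N))); apply: nearW => r.
    by rewrite leNgt; apply/negP => lt; apply: nr; exists r.
  by rewrite lee_fin leNgt e20.
exists (`|K1| + `|K2|) => [|i]; first by rewrite addr_ge0.
rewrite [eta]splitr EFinD; apply: leeD.
- apply: le_trans (ltW K1e); rewrite -(ie.2 i).
  apply: cdf_nondecreasing.
  have := ler_norm (- K1); have := normr_ge0 K2; rewrite normrN; lra.
- apply: le_trans (ltW K2e); rewrite -(iid_ccdf i ie).
  apply: ccdf_nonincreasing.
  have := ler_norm K2; have := normr_ge0 K1; lra.
Qed.

End iid_sequences.

(** * Combination of the numerator and denominator bounds *)

Theorem theorem5 (R : realType) (d : measure_display) (T : measurableType d)
  (P : probability T R) (a b : R) (h : R -> R) (eps : nat -> {RV P >-> R}) :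
  a < b ->
  {within `[a, b], continuous h} ->
  (forall x, x \in `]a, b[ -> derivable h x 1) ->
  {within `]a, b[, continuous (derive1 h)} ->
  (exists M : R, forall x, x \in `]a, b[ -> `|(derive1 h) x| <= M) ->
  iid eps ->
  ~ degenerate_cdf (cdf (eps 0%N)) ->
  P.-integrable setT (fun w => ((eps 0%N w) ^+ 2)%:E) ->
  ('E_P[eps 0%N] = 0)%E ->
  cvg_in_prob P (I_stat h a b eps) (1 / 2).
Proof.
move=> ab hc hd _ [M hM] ie ndeg _ _ e e0.
have mI n : measurable [set w | e <= `|I_stat h a b eps n w - 1 / 2|].
  have := @measurable_preim_itv R d T
    (fun w => `|I_stat h a b eps n w - 1 / 2|) `[e, +oo[.
  rewrite set_itvE; apply; apply: measurableT_comp => //.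
  by apply: measurable_funB => //; exact: measurable_I_stat.
apply/fine_cvgP; split; first by apply: nearW => n; exact: fin_num_measure.
apply/cvgrPdist_le => eta eta0.
have eta3 : 0 < eta / 3 by lra.
have [K K0 Ktail] := iid_tail eps _ ie eta3.
pose C := M * (b - a).
(* Here [C + 2 * K] will bound [|Y_n - Y_1|], division by [2 * e] matches [I_stat_deviation], and
   the last [C] pays for the drift of [h]. *)
have [N Nvar] := variation_unbounded eps
  ((C + 2 * K) / (2 * e) + C) _ ie ndeg eta3.
(* [N.+1] because [n] observations give only [n.-1] increments. *)
exists (maxn 2 N.+1) => // n /=; rewrite geq_max => /andP[n1 Nn].
rewrite sub0r normrN ger0_norm ?fine_ge0// -lee_fin fineK ?fin_num_measure//.
pose tail i := eps i @^-1` `]-oo, (- K)] `|` eps i @^-1` `]K, +oo[.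
have mtail i : measurable (tail i).
  by apply: measurableU; exact: measurable_preim_itv.
have Ptail i : (P (tail i) <= (eta / 3)%:E)%E.
  by apply: le_trans (Ktail i); apply: measureU2; exact: measurable_preim_itv.
pose V := [set w | variation eps n.-1 w <= (C + 2 * K) / (2 * e) + C].
have mV : measurable V.
  have := @measurable_preim_itv R d T (variation eps n.-1)
    `]-oo, (C + 2 * K) / (2 * e) + C].
  by rewrite set_itvE; apply; exact: measurable_variation.
have PV : (P V <= (eta / 3)%:E)%E by apply: Nvar; lia.
(* A deviation of size [e] needs an extreme first or last error or a small variation, each of
   probability at most [eta / 3]. *)
apply: (@le_trans _ _ (P (tail 0%N `|` tail n.-1 `|` V))).
  apply: le_measure; rewrite ?inE//; first by do 2 apply: measurableU => //.
  move=> w /= /(I_stat_deviation _ _ _ _ _ _ _ n1) dev.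
  apply: contrapT => /not_orP[/not_orP[w0 wn] wV]; apply: wV.
  have epsK i : ~ tail i w -> `|eps i w| <= K.
    rewrite /tail/= !in_itv/= andbT => /not_orP[/negP]; rewrite -ltNge => w1.
    by move=> /negP; rewrite -leNgt => w2; rewrite ler_norml w2 ltW.
  have hab : `|h b - h a| <= C by exact: (derive_bounded_lipschitz R h a b).
  have var := Yobs_variation_ge h a b eps M n w ab hc hd hM n1.
  (* The extreme design points are exactly [a] and [b], so the drift part is [h b - h a]. *)
  have YC : `|Yobs h a b eps n n w - Yobs h a b eps n 1 w| <= C + 2 * K.
    have xn : xdes a b n n = b.
      by rewrite /xdes divff ?mulr1 ?subrKC// pnatr_eq0 -lt0n; lia.
    have x1 : xdes a b n 1 = a by rewrite /xdes mul0r mulr0 addr0.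
    rewrite /Yobs xn x1/=.
    rewrite (_ : _ - _ = (h b - h a) + (eps n.-1 w - eps 0%N w)); last by ring.
    apply: le_trans (ler_normD _ _) _; apply: lerD => //.
    apply: le_trans (ler_normB _ _) _; rewrite mulr_natl mulr2n.
    by apply: lerD; exact: epsK.
  rewrite /V/= -lerBlDr; apply: le_trans var _.
  rewrite ler_pdivlMr; last by rewrite mulr_gt0.
  by rewrite mulrC; exact: le_trans dev YC.
rewrite (_ : eta = eta / 3 + eta / 3 + eta / 3); last by field.
rewrite !EFinD; apply: le_trans (measureU2 _ _ _) _ => //.
  exact: measurableU.
apply: leeD => //; apply: le_trans (measureU2 _ _ _) _ => //.
by apply: leeD; exact: Ptail.
Qed.
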